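(* Let $\Omega$ be sampled according to the Bernoulli model with $p=m/(n_1n_2)$ and put $n=\max(n_1,n_2)$. Suppose $\max(\mu(U),\mu(V))\le\mu_0$. Then there is a numerical constant $C_R$ such that for all $\beta>1$, $$p^{-1}\,\|\mathcal{P}_T\mathcal{P}_\Omega\mathcal{P}_T-p\,\mathcal{P}_T\|\le C_R\sqrt{\frac{\mu_0\,n r\,(\beta\log n)}{m}}$$ with probability at least $1-3n^{-\beta}$, provided that $C_R\sqrt{\mu_0 nr(\beta\log n)/m}<1$.
   Context: Setup: $U\subseteq\mathbb{R}^{n_1}$, $V\subseteq\mathbb{R}^{n_2}$ are $r$-dimensional subspaces (column and row spaces of a rank-$r$ matrix $M=\sum_{k=1}^r\sigma_ku_kv_k^*$) with orthogonal projections $P_U,P_V$. Coherence: for an $r$-dimensional subspace $W\subseteq\mathbb{R}^d$, $\mu(W)=\frac dr\max_{1\le i\le d}\|P_We_i\|^2$. $T$ is the subspace of $\mathbb{R}^{n_1\times n_2}$ spanned by matrices $u_kx^*$ and $yv_k^*$; $\mathcal{P}_T(X)=P_UX+XP_V-P_UXP_V$. Bernoulli model: $\{\delta_{ab}\}$ are i.i.d. $0/1$ variables with $\mathbb{P}(\delta_{ab}=1)=p$, $\Omega=\{(a,b):\delta_{ab}=1\}$, and $\mathcal{P}_\Omega(X)$ keeps the entries of $X$ in $\Omega$ and sets the others to zero. For a linear map $\mathcal{A}$ on $\mathbb{R}^{n_1\times n_2}$, $\|\mathcal{A}\|=\sup_{\|X\|_F\le1}\|\mathcal{A}(X)\|_F$.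 *)

(* Defs.v *)
From Stdlib Require Import Reals List Classical ClassicalEpsilon.
Open Scope R_scope.

(* Real matrices are functions nat -> nat -> R; only entries (a,b) with
   a < n1, b < n2 matter.  Vectors are functions nat -> R. *)
Definition Mat := nat -> nat -> R.

Fixpoint sumR (n : nat) (f : nat -> R) : R :=
  match n with O => 0 | S k => sumR k f + f k end.

Fixpoint maxR (n : nat) (f : nat -> R) : R :=
  match n with O => f O | S O => f O | S k => Rmax (maxR k f) (f k) end.

Definition frob (n1 n2 : nat) (X : Mat) : R :=
  sqrt (sumR n1 (fun a => sumR n2 (fun b => X a b ^ 2))).

Definition orthonormal (d r : nat) (u : nat -> nat -> R) : Prop :=
  forall k l, (k < r)%nat -> (l < r)%nat ->
    sumR d (fun a => u k a * u l a) = if Nat.eqb k l then 1 else 0.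

Definition proj (r : nat) (u : nat -> nat -> R) : Mat :=
  fun a c => sumR r (fun k => u k a * u k c).

Definition coherence (d r : nat) (P : Mat) : R :=
  INR d / INR r * maxR d (fun i => sumR d (fun j => P j i ^ 2)).

Definition mulmat (n : nat) (A B : Mat) : Mat :=
  fun a b => sumR n (fun c => A a c * B c b).
Definition PT (n1 n2 : nat) (PU PV : Mat) (X : Mat) : Mat :=
  fun a b => mulmat n1 PU X a b + mulmat n2 X PV a b
             - mulmat n2 (mulmat n1 PU X) PV a b.

Definition POmega (delta : nat -> nat -> bool) (X : Mat) : Mat :=
  fun a b => if delta a b then X a b else 0.

Definition upd (d : nat -> nat -> bool) (a b : nat) (v : bool) :=
  fun a' b' => if andb (Nat.eqb a a') (Nat.eqb b b') then v else d a' b'.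

(* Expectation of F under independent Bernoulli(p) bits on the given
   (distinct) cells; bits outside the cells are false. *)
Fixpoint bern_exp (p : R) (cells : list (nat * nat))
    (F : (nat -> nat -> bool) -> R) : R :=
  match cells with
  | nil => F (fun _ _ => false)
  | (a, b) :: cs =>
      p * bern_exp p cs (fun d => F (upd d a b true))
      + (1 - p) * bern_exp p cs (fun d => F (upd d a b false))
  end.

Definition indicator {A} (E : A -> Prop) (x : A) : R :=
  if excluded_middle_informative (E x) then 1 else 0.

Definition bern_prob (p : R) (n1 n2 : nat)
    (E : (nat -> nat -> bool) -> Prop) : R :=
  bern_exp p (list_prod (seq 0 n1) (seq 0 n2)) (indicator E).

(* Main.v *)
(** Let [G] be the matrix of [P_T] in the basis of the cells, so that its rows
    [G i] form a Parseval frame of [T]. Up to the factor [p], the operator of the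
    theorem is [S = sum_i c_i <G i, .> G i] with [c_i = delta_i / p - 1]
    independent and centered. The trace moments [M_k = tr (P_T S^k)] are bounded
    as in the exchangeable pairs method: conditioning on one bit turns
    [E M_(2N+2)] into a sum of differences [<G i, (S1^k - S0^k) G i>] with
    [k = 2N + 1] and [S1 - S0] of rank one, which telescope into mixed moments
    [<G i, S1^j G i> <G i, S0^(2N-j) G i>], controlled by log-convexity. Since
    [|G i|^2 <= B], this closes into
      [E M_(2N+2) <= (2N+1) B / (2p) (E M_(2N+1) + 2 E M_(2N))],
    hence [E M_(2q) <= (5 q B / p)^q n1 n2] whenever [q B / p <= 1]. Incoherence
    gives [B / p <= 2 mu0 n r / m], and Markov's inequality with
    [q ~ 3 beta log n] concludes. *)

Require Import Defs.
From Stdlib Require Import Reals ZArith List Lra Lia.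
From Stdlib Require Import Classical ClassicalEpsilon FunctionalExtensionality.
Open Scope R_scope.

(** * Finite sums over lists *)

Definition lsum {A : Type} (l : list A) (f : A -> R) : R :=
  fold_right (fun x s => f x + s) 0 l.

Lemma lsum_ext {A} (l : list A) f g :
  (forall x, In x l -> f x = g x) -> lsum l f = lsum l g.
Proof.
  induction l as [|x l IH]; simpl; intros H; [reflexivity|].
  rewrite (H x), IH; auto.
Qed.

Lemma lsum_plus {A} (l : list A) f g :
  lsum l (fun x => f x + g x) = lsum l f + lsum l g.
Proof. induction l as [|x l IH]; simpl; [lra|]. rewrite IH; lra. Qed.

Lemma lsum_scal {A} (l : list A) a f :
  lsum l (fun x => a * f x) = a * lsum l f.
Proof. induction l as [|x l IH]; simpl; [lra|]. rewrite IH; lra. Qed.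

Lemma lsum_zero {A} (l : list A) f :
  (forall x, In x l -> f x = 0) -> lsum l f = 0.
Proof.
  induction l as [|x l IH]; simpl; intros H; [reflexivity|].
  rewrite (H x), IH; auto; lra.
Qed.

Lemma lsum_le {A} (l : list A) f g :
  (forall x, In x l -> f x <= g x) -> lsum l f <= lsum l g.
Proof.
  induction l as [|x l IH]; simpl; intros H; [lra|].
  apply Rplus_le_compat; auto.
Qed.

Lemma lsum_nonneg {A} (l : list A) f :
  (forall x, In x l -> 0 <= f x) -> 0 <= lsum l f.
Proof.
  intros H. rewrite <- (lsum_zero l (fun _ => 0)) by auto.
  apply lsum_le, H.
Qed.

Lemma lsum_swap {A B} (l : list A) (s : list B) f :
  lsum l (fun x => lsum s (f x)) = lsum s (fun y => lsum l (fun x => f x y)).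
Proof.
  induction l as [|x l IH]; simpl.
  - symmetry; apply lsum_zero; auto.
  - rewrite IH, <- lsum_plus; reflexivity.
Qed.

Lemma lsum_single {A} (l : list A) e f :
  NoDup l -> In e l -> (forall x, In x l -> x <> e -> f x = 0) ->
  lsum l f = f e.
Proof.
  induction 1 as [|x l Hx Hl IH]; simpl; [tauto|].
  intros [->|He] H.
  - rewrite (lsum_zero l f); [lra|]. intros y Hy. apply H; auto. congruence.
  - rewrite IH; auto. rewrite (H x); auto; [lra|]. congruence.
Qed.

Lemma lsum_ge_term {A} (l : list A) e f :
  In e l -> (forall x, 0 <= f x) -> f e <= lsum l f.
Proof.
  intros He Hf; induction l as [|x l IH]; simpl in *; [tauto|].
  pose proof (Hf x). pose proof (lsum_nonneg l f ltac:(auto)).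
  destruct He as [->|He]; [lra|]. specialize (IH He); lra.
Qed.

Lemma lsum_app {A} (l l' : list A) f : lsum (l ++ l') f = lsum l f + lsum l' f.
Proof. induction l as [|x l IH]; simpl; [lra|]. rewrite IH; lra. Qed.

Lemma lsum_map {A B} (h : A -> B) l f :
  lsum (map h l) f = lsum l (fun x => f (h x)).
Proof. induction l as [|x l IH]; simpl; [|rewrite IH]; reflexivity. Qed.

Lemma lsum_const {A} (l : list A) a : lsum l (fun _ => a) = INR (length l) * a.
Proof.
  induction l as [|x l IH]; cbn [lsum fold_right length]; [simpl; lra|].
  fold (lsum l (fun _ => a)). rewrite IH, S_INR; lra.
Qed.

Lemma lsum_list_prod {A B} (l : list A) (s : list B) f :
  lsum (list_prod l s) f = lsum l (fun x => lsum s (fun y => f (x, y))).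
Proof.
  induction l as [|x l IH]; simpl; [reflexivity|].
  rewrite lsum_app, lsum_map, IH; reflexivity.
Qed.

Lemma sumR_lsum n f : sumR n f = lsum (seq 0 n) f.
Proof.
  induction n as [|n IH]; [reflexivity|].
  rewrite seq_S, lsum_app; simpl. rewrite IH; lra.
Qed.

(** Reflecting the index lets [mixed_moments_sum] pair [j] with [2 * N - j]. *)
Lemma sumR_rev n f : sumR n (fun j => f (n - 1 - j)%nat) = sumR n f.
Proof.
  assert (shift : forall k g, sumR (S k) g = g O + sumR k (fun j => g (S j))).
  { intros k g. induction k as [|k IH]; [simpl; lra|].
    change (sumR (S (S k)) g) with (sumR (S k) g + g (S k)).
    rewrite IH; simpl; lra. }
  induction n as [|n IH]; [reflexivity|].
  rewrite shift. simpl (sumR (S n) f). rewrite <- IH, !sumR_lsum.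
  replace (S n - 1 - 0)%nat with n by lia.
  rewrite Rplus_comm. f_equal. apply lsum_ext; intros j _; f_equal; lia.
Qed.

(** * Inner products and the Cauchy-Schwarz inequality *)

Definition dot {A : Type} (l : list A) (X Y : A -> R) : R :=
  lsum l (fun i => X i * Y i).

Lemma dot_comm {A} (l : list A) X Y : dot l X Y = dot l Y X.
Proof. apply lsum_ext; intros; ring. Qed.

Lemma dot_ext_r {A} (l : list A) X Y Z :
  (forall i, In i l -> Y i = Z i) -> dot l X Y = dot l X Z.
Proof. intros H; apply lsum_ext; intros i Hi; rewrite H; auto. Qed.

Lemma dot_plus_r {A} (l : list A) X Y Z :
  dot l X (fun i => Y i + Z i) = dot l X Y + dot l X Z.
Proof. unfold dot; rewrite <- lsum_plus; apply lsum_ext; intros; ring. Qed.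

Lemma dot_scal_r {A} (l : list A) X a Y :
  dot l X (fun i => a * Y i) = a * dot l X Y.
Proof. unfold dot; rewrite <- lsum_scal; apply lsum_ext; intros; ring. Qed.

Lemma dot_lsum_r {A B} (l : list A) (s : list B) X c (W : B -> A -> R) :
  dot l X (fun x => lsum s (fun i => c i * W i x))
  = lsum s (fun i => c i * dot l X (W i)).
Proof.
  unfold dot.
  rewrite (lsum_ext l _ (fun x => lsum s (fun i => c i * (X x * W i x)))).
  - rewrite lsum_swap; apply lsum_ext; intros; apply lsum_scal.
  - intros x _. rewrite <- lsum_scal; apply lsum_ext; intros; ring.
Qed.

Lemma dot_nonneg {A} (l : list A) X : 0 <= dot l X X.
Proof. apply lsum_nonneg; intros; nra. Qed.

Lemma dot_cauchy {A} (l : list A) X Y :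
  dot l X Y ^ 2 <= dot l X X * dot l Y Y.
Proof.
  assert (H : forall t,
    0 <= dot l X X + 2 * t * dot l X Y + t * t * dot l Y Y).
  { intros t.
    pose proof (dot_nonneg l (fun i => X i + t * Y i)) as H.
    rewrite dot_plus_r, dot_scal_r, !(dot_comm l (fun i => X i + t * Y i)),
      !dot_plus_r, !dot_scal_r, (dot_comm l Y X) in H. lra. }
  pose proof (dot_nonneg l X) as HX. pose proof (dot_nonneg l Y) as HY.
  set (x := dot l X X) in *; set (y := dot l Y Y) in *;
    set (z := dot l X Y) in *.
  destruct (Req_dec y 0) as [Hy|Hy].
  - destruct (Req_dec z 0) as [Hz|Hz]; [rewrite Hz; nra|].
    (* With [y = 0] the quadratic in [t] is affine with slope [2 * z]; this [t] gives it the value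
       -1. *)
    specialize (H (- (x + 1) / (2 * z))). rewrite Hy in H.
    replace (x + 2 * (- (x + 1) / (2 * z)) * z + _) with (-1) in H
      by (field; auto). lra.
  (* The minimiser of the quadratic. *)
  - specialize (H (- z / y)).
    replace (x + 2 * (- z / y) * z + - z / y * (- z / y) * y)
      with ((x * y - z ^ 2) / y) in H by (field; auto).
    assert (0 <= (x * y - z ^ 2) / y * y) by (apply Rmult_le_pos; lra).
    replace ((x * y - z ^ 2) / y * y) with (x * y - z ^ 2) in * by (field; auto).
    lra.
Qed.

(** * Mixed moments of two log-convex sequences *)

(* The sequences [k |-> <w, S^k w>] with [S] symmetric have this property. *)
Definition hankel_nonneg (a : nat -> R) : Prop :=
  (forall i, 0 <= a (2 * i)%nat) /\
  (forall i j, a (i + j)%nat ^ 2 <= a (2 * i)%nat * a (2 * j)%nat).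

(** Multiplying the two hypotheses gives [(x * x')^2 <= (y * z') * (z * y')]; the
    arithmetic-geometric mean inequality for [y * z'] and [z * y'] finishes. *)
Lemma mixed_am_gm x y z x' y' z' :
  0 <= y -> 0 <= z -> 0 <= y' -> 0 <= z' ->
  x ^ 2 <= y * z -> x' ^ 2 <= y' * z' -> 2 * (x * x') <= y * z' + z * y'.
Proof.
  intros Hy Hz Hy' Hz' H H'.
  assert (0 <= y * z') by (apply Rmult_le_pos; auto).
  assert (0 <= z * y') by (apply Rmult_le_pos; auto).
  assert (E : (x * x') ^ 2 <= (y * z') * (z * y')).
  { replace ((x * x') ^ 2) with (x ^ 2 * x' ^ 2) by ring.
    replace (y * z' * (z * y')) with (y * z * (y' * z')) by ring.
    apply Rmult_le_compat; auto using pow2_ge_0. }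
  pose proof (pow2_ge_0 (y * z' - z * y')).
  apply Rnot_lt_le; intros L. nra.
Qed.

(** Midpoint convexity makes the increments of [f] nondecreasing, so the first [i] of them add up to
    at most the last [i]. *)
Lemma convex_endpoints (f : nat -> R) N :
  (forall i, (S (S i) <= N)%nat -> 2 * f (S i) <= f i + f (S (S i))) ->
  forall i, (i <= N)%nat -> f i + f (N - i)%nat <= f O + f N.
Proof.
  intros H.
  assert (step : forall i s, (S (i + s) <= N)%nat ->
    f (S s) - f s <= f (S (i + s)) - f (i + s)%nat).
  { induction i as [|i IH]; intros s Hs; [simpl; lra|].
    specialize (IH s ltac:(lia)). specialize (H (i + s)%nat ltac:(lia)).
    simpl in *; lra. }
  assert (shift : forall i s, (i + s <= N)%nat ->
    f i - f O <= f (i + s)%nat - f s).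
  { intros i s; induction s as [|s IH]; intros Hs.
    - rewrite Nat.add_0_r; lra.
    - specialize (IH ltac:(lia)). specialize (step i s ltac:(lia)).
      rewrite Nat.add_succ_r; lra. }
  intros i Hi. specialize (shift i (N - i)%nat ltac:(lia)).
  replace (i + (N - i))%nat with N in shift by lia. lra.
Qed.

(* For commuting symmetric [L], [M] this is
   [L^j M^(2N-j) + L^(2N-j) M^j <= L^(2N) + M^(2N)]. *)
Lemma mixed_moments_pair a b N j :
  hankel_nonneg a -> hankel_nonneg b -> (j <= 2 * N)%nat ->
  a j * b (2 * N - j)%nat + a (2 * N - j)%nat * b j
  <= a O * b (2 * N)%nat + a (2 * N)%nat * b O.
Proof.
  intros [a0 ac] [b0 bc] Hj.
  (* The products at even indices form a convex sequence by [mixed_am_gm]; the signs of odd entries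
     are unknown, so those are treated separately. *)
  set (f := fun i => a (2 * i)%nat * b (2 * (N - i))%nat).
  assert (conv : forall i, (i <= N)%nat -> f i + f (N - i)%nat <= f O + f N).
  { apply convex_endpoints. intros i Hi. unfold f.
    pose proof (ac i (S (S i))) as A. pose proof (bc (N - i)%nat (N - S (S i))%nat) as B.
    replace (i + S (S i))%nat with (2 * S i)%nat in A by lia.
    replace (N - i + (N - S (S i)))%nat with (2 * (N - S i))%nat in B by lia.
    pose proof (mixed_am_gm _ _ _ _ _ _ (a0 i) (a0 (S (S i)))
      (b0 (N - S (S i))%nat) (b0 (N - i)%nat) A ltac:(rewrite Rmult_comm; exact B)).
    lra. }
  assert (F0 : f O + f N = a O * b (2 * N)%nat + a (2 * N)%nat * b O).
  { unfold f. rewrite Nat.sub_diag, Nat.sub_0_r. reflexivity. }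
  rewrite <- F0.
  destruct (Nat.Even_or_Odd j) as [[i ->]|[i ->]].
  - specialize (conv i ltac:(lia)). unfold f in conv at 1 2.
    replace (N - (N - i))%nat with i in conv by lia.
    replace (2 * N - 2 * i)%nat with (2 * (N - i))%nat by lia. lra.
  (* A product at an odd index is at most the average of its two even neighbours, which reduces the
     odd case to the even one. *)
  - assert (odd : forall k, (S k <= N)%nat ->
      2 * (a (2 * k + 1)%nat * b (2 * (N - S k) + 1)%nat) <= f k + f (S k)).
    { intros k Hk. unfold f.
      pose proof (ac k (S k)) as A. pose proof (bc (N - k)%nat (N - S k)%nat) as B.
      replace (k + S k)%nat with (2 * k + 1)%nat in A by lia.
      replace (N - k + (N - S k))%nat with (2 * (N - S k) + 1)%nat in B by lia.
      pose proof (mixed_am_gm _ _ _ _ _ _ (a0 k) (a0 (S k))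
        (b0 (N - S k)%nat) (b0 (N - k)%nat) A ltac:(rewrite Rmult_comm; exact B)).
      lra. }
    pose proof (odd i ltac:(lia)) as O1.
    pose proof (odd (N - S i)%nat ltac:(lia)) as O2.
    pose proof (conv i ltac:(lia)) as C1.
    pose proof (conv (S i) ltac:(lia)) as C2.
    replace (N - S (N - S i))%nat with i in O2 by lia.
    replace (S (N - S i)) with (N - i)%nat in O2 by lia.
    replace (2 * N - (2 * i + 1))%nat with (2 * (N - S i) + 1)%nat by lia.
    lra.
Qed.

(** The doubled sum is the sum plus its reflection; each of the [2 * N + 1] resulting pairs is
    bounded by [mixed_moments_pair]. *)
Lemma mixed_moments_sum a b N :
  hankel_nonneg a -> hankel_nonneg b ->
  2 * sumR (2 * N + 1) (fun j => a j * b (2 * N - j)%nat)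
  <= INR (2 * N + 1) * (a O * b (2 * N)%nat + a (2 * N)%nat * b O).
Proof.
  intros Ha Hb.
  set (f := fun j => a j * b (2 * N - j)%nat).
  replace (2 * sumR (2 * N + 1) f) with (sumR (2 * N + 1) f
    + sumR (2 * N + 1) (fun j => f (2 * N + 1 - 1 - j)%nat))
    by (rewrite sumR_rev; ring).
  rewrite !sumR_lsum, <- lsum_plus.
  rewrite <- (length_seq (2 * N + 1) 0) at 2. rewrite <- lsum_const.
  apply lsum_le. intros j Hj. apply in_seq in Hj. unfold f.
  replace (2 * N - (2 * N + 1 - 1 - j))%nat with j by lia.
  replace (2 * N + 1 - 1 - j)%nat with (2 * N - j)%nat by lia.
  apply mixed_moments_pair; auto; lia.
Qed.

(** * Weighted frame operators and their trace moments *)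

Section Frame.

Context {A : Type} (l : list A) (G : A -> A -> R).
Hypothesis l_nodup : NoDup l.
Hypothesis G_sym : forall i j, G i j = G j i.
Hypothesis G_idem : forall i j, In i l -> In j l -> dot l (G i) (G j) = G i j.

Definition frame_op (c : A -> R) (X : A -> R) : A -> R :=
  fun x => lsum l (fun i => c i * dot l (G i) X * G i x).

Definition frame_pow (c : A -> R) (k : nat) (X : A -> R) : A -> R :=
  Nat.iter k (frame_op c) X.

Lemma dot_frame_op_r c X Y :
  dot l X (frame_op c Y) = lsum l (fun i => c i * dot l (G i) Y * dot l X (G i)).
Proof. unfold frame_op; apply dot_lsum_r. Qed.

Lemma frame_op_sym c X Y : dot l (frame_op c X) Y = dot l X (frame_op c Y).
Proof.
  rewrite dot_comm, !dot_frame_op_r. apply lsum_ext; intros.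
  rewrite (dot_comm l X), (dot_comm l Y); ring.
Qed.

Lemma frame_pow_shift c k X : frame_pow c k (frame_op c X) = frame_pow c (S k) X.
Proof. symmetry; apply Nat.iter_succ_r. Qed.

Lemma dot_frame_pow c j k X Y :
  dot l (frame_pow c j X) (frame_pow c k Y) = dot l X (frame_pow c (j + k) Y).
Proof.
  revert X; induction j as [|j IH]; intros X; [reflexivity|].
  rewrite <- frame_pow_shift, IH, frame_op_sym; reflexivity.
Qed.

(** Self-adjointness splits [S^(i+j)] between the two arguments: even moments become squared norms,
    and the other inequality is Cauchy-Schwarz for [S^i X] and [S^j X]. *)
Lemma hankel_frame_pow c X : hankel_nonneg (fun k => dot l X (frame_pow c k X)).
Proof.
  split.
  - intros i. replace (2 * i)%nat with (i + i)%nat by lia.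
    rewrite <- dot_frame_pow; apply dot_nonneg.
  - intros i j. replace (2 * i)%nat with (i + i)%nat by lia.
    replace (2 * j)%nat with (j + j)%nat by lia.
    rewrite <- !dot_frame_pow; apply dot_cauchy.
Qed.

Lemma frame_op_perturb c0 c1 e t u Z :
  In e l -> c1 e = c0 e + t -> (forall i, In i l -> i <> e -> c1 i = c0 i) ->
  dot l u (frame_op c1 Z)
  = dot l u (frame_op c0 Z) + t * (dot l (G e) Z * dot l u (G e)).
Proof.
  intros He H1 H2. rewrite !dot_frame_op_r.
  rewrite (lsum_ext l (fun i => c1 i * _ * _) (fun i =>
    c0 i * dot l (G i) Z * dot l u (G i)
    + (c1 i - c0 i) * (dot l (G i) Z * dot l u (G i)))) by (intros; ring).
  rewrite lsum_plus; f_equal.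
  rewrite (lsum_single l e); auto.
  - rewrite H1; ring.
  - intros i Hi Hne. rewrite (H2 i); auto; ring.
Qed.

(* [S1^k - S0^k = sum_j S0^(k-1-j) (S1 - S0) S1^j], with [S1 - S0] of rank one. *)
Lemma frame_pow_perturb c0 c1 e t k u :
  In e l -> c1 e = c0 e + t -> (forall i, In i l -> i <> e -> c1 i = c0 i) ->
  dot l u (frame_pow c1 k (G e)) = dot l u (frame_pow c0 k (G e))
    + t * sumR k (fun j => dot l (G e) (frame_pow c1 j (G e))
                           * dot l u (frame_pow c0 (k - 1 - j) (G e))).
Proof.
  (* The induction is over all [u], since its step moves one factor of the unperturbed operator onto
     the test vector. *)
  intros He H1 H2. revert u; induction k as [|k IH]; intros u.
  - simpl; ring.
  - change (frame_pow c1 (S k) (G e)) with (frame_op c1 (frame_pow c1 k (G e))).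
    rewrite (frame_op_perturb c0 c1 e t) by auto.
    rewrite <- frame_op_sym, IH, frame_op_sym.
    change (frame_op c0 (frame_pow c0 k (G e))) with (frame_pow c0 (S k) (G e)).
    simpl (sumR (S k) _). rewrite (Nat.sub_0_r k), Nat.sub_diag.
    rewrite !sumR_lsum.
    rewrite (lsum_ext (seq 0 k)
      (fun j => dot l (G e) (frame_pow c1 j (G e))
                * dot l (frame_op c0 u) (frame_pow c0 (k - 1 - j) (G e)))
      (fun j => dot l (G e) (frame_pow c1 j (G e))
                * dot l u (frame_pow c0 (k - j) (G e)))).
    + simpl (frame_pow c0 0 (G e)). ring.
    + intros j Hj. apply in_seq in Hj. rewrite frame_op_sym.
      replace (k - j)%nat with (S (k - 1 - j)) by lia. reflexivity.
Qed.

(** With test vector [G e], the telescoped sum is a sum of products of two Hankel sequences. By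
    [mixed_moments_sum] only its two extreme products matter, and in these the zeroth moment is
    [G e e]. *)
Lemma frame_pow_perturb_bound c0 c1 e t N :
  0 <= t ->
  In e l -> c1 e = c0 e + t -> (forall i, In i l -> i <> e -> c1 i = c0 i) ->
  dot l (G e) (frame_pow c1 (2 * N + 1) (G e))
    - dot l (G e) (frame_pow c0 (2 * N + 1) (G e))
  <= t * INR (2 * N + 1) / 2 * G e e
     * (dot l (G e) (frame_pow c1 (2 * N) (G e)) + dot l (G e) (frame_pow c0 (2 * N) (G e))).
Proof.
  intros Ht He H1 H2.
  rewrite (frame_pow_perturb c0 c1 e t) by auto.
  pose proof (mixed_moments_sum _ _ N (hankel_frame_pow c1 (G e)) (hankel_frame_pow c0 (G e)))
    as M.
  cbv beta in M. simpl (frame_pow _ 0 _) in M. rewrite (G_idem e e) in M by auto.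
  replace (2 * N + 1 - 1)%nat with (2 * N)%nat by lia.
  apply (Rmult_le_compat_l t) in M; auto. lra.
Qed.

(** The Parseval identity: [G] is a symmetric idempotent, so the sum of the [<G i, Y> G i] is the
    projection of [Y], and [G j] lies in the range. *)
Lemma frame_expand Y j :
  In j l -> lsum l (fun i => dot l (G i) Y * dot l (G i) (G j)) = dot l (G j) Y.
Proof.
  intros Hj.
  rewrite (lsum_ext l _ (fun i => lsum l (fun x => Y x * (G x i * G j i)))).
  - rewrite lsum_swap. apply lsum_ext. intros x Hx.
    rewrite lsum_scal. fold (dot l (G x) (G j)). rewrite G_idem by auto.
    rewrite (G_sym x j); ring.
  - intros i Hi. rewrite G_idem by auto. unfold dot.
    rewrite Rmult_comm, <- lsum_scal. apply lsum_ext; intros x _.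
    rewrite (G_sym x i), (G_sym j i). ring.
Qed.

(** The trace of [G S^k G]; for [k = 0] it is the trace of [G]. *)
Definition moment (c : A -> R) (k : nat) : R :=
  lsum l (fun i => dot l (G i) (frame_pow c k (G i))).

(** Expanding one factor [S] and summing over [i] by [frame_expand] isolates the weight [c j] as a
    linear factor, ready for conditioning on the bit of cell [j]. *)
Lemma moment_succ c k :
  moment c (S k) = lsum l (fun j => c j * dot l (G j) (frame_pow c k (G j))).
Proof.
  unfold moment.
  rewrite (lsum_ext l _ (fun i => lsum l (fun j =>
    c j * (dot l (G i) (frame_pow c k (G j)) * dot l (G i) (G j))))).
  - rewrite lsum_swap. apply lsum_ext. intros j Hj.
    rewrite lsum_scal, frame_expand by auto. reflexivity.
  - intros i Hi.
    change (frame_pow c (S k) (G i)) with (frame_op c (frame_pow c k (G i))).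
    rewrite dot_frame_op_r. apply lsum_ext. intros j Hj.
    replace (dot l (G j) (frame_pow c k (G i))) with (dot l (G i) (frame_pow c k (G j))).
    + ring.
    + pose proof (dot_frame_pow c k 0 (G j) (G i)) as E.
      rewrite Nat.add_0_r in E. rewrite <- E. apply dot_comm.
Qed.

(** Termwise, this is the nonnegativity of [|S^(N+1) G i - S^N G i|^2]. *)
Lemma moment_odd_le c N :
  moment c (2 * N + 1) <= (moment c (2 * N) + moment c (2 * (N + 1))) / 2.
Proof.
  unfold moment. unfold Rdiv. rewrite Rmult_comm, <- lsum_plus, <- lsum_scal.
  apply lsum_le; intros i _.
  replace (2 * N)%nat with (N + N)%nat by lia.
  replace (2 * (N + 1))%nat with (S N + S N)%nat by lia.
  replace (N + N + 1)%nat with (S N + N)%nat by lia.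
  rewrite <- !dot_frame_pow.
  set (X := frame_pow c N (G i)). set (Y := frame_pow c (S N) (G i)).
  pose proof (dot_nonneg l (fun x => Y x + (-1) * X x)) as H.
  rewrite dot_plus_r, dot_scal_r, !(dot_comm l (fun x => Y x + -1 * X x)),
    !dot_plus_r, !dot_scal_r, (dot_comm l X Y) in H. lra.
Qed.

Lemma moment_even_nonneg c N : 0 <= moment c (2 * N).
Proof. apply lsum_nonneg; intros i _; apply (hankel_frame_pow c (G i)). Qed.

Lemma G_diag_le_1 i : In i l -> G i i <= 1.
Proof.
  intros Hi. pose proof (G_idem i i Hi Hi) as H.
  pose proof (lsum_ge_term l i (fun x => G i x * G i x) Hi
    (fun x => Rle_0_sqr (G i x))) as L.
  fold (dot l (G i) (G i)) in L. rewrite H in L. nra.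
Qed.

Lemma moment_zero_le c : moment c 0 <= INR (length l).
Proof.
  rewrite <- (Rmult_1_r (INR _)), <- lsum_const.
  apply lsum_le; intros i Hi. simpl. rewrite G_idem by auto.
  apply G_diag_le_1; auto.
Qed.

(** A positive power of [S] has its values in the range of [G], so the entry of [S^(q+1) X] at [i]
    is [<S^(q+1) G i, X>]; Cauchy-Schwarz and summation over [i] give the trace. *)
Lemma frame_pow_norm_le_moment c q X :
  dot l (frame_pow c (S q) X) (frame_pow c (S q) X) <= moment c (2 * S q) * dot l X X.
Proof.
  rewrite Rmult_comm. unfold moment. rewrite <- lsum_scal.
  apply lsum_le; intros i Hi.
  assert (E : frame_pow c (S q) X i = dot l (G i) (frame_pow c (S q) X)).
  { change (frame_pow c (S q) X) with (frame_op c (frame_pow c q X)). rewrite dot_frame_op_r.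
    apply lsum_ext; intros j Hj. rewrite G_idem, G_sym by auto. reflexivity. }
  rewrite E.
  replace (2 * S q)%nat with (S q + S q)%nat by lia.
  rewrite <- dot_frame_pow.
  pose proof (dot_frame_pow c (S q) 0 (G i) X) as F. rewrite Nat.add_0_r in F.
  rewrite <- F. cbn [frame_pow Nat.iter].
  pose proof (dot_cauchy l (frame_pow c (S q) (G i)) X). unfold frame_pow in *; simpl in *. lra.
Qed.

(** This replaces a spectral argument: [j |-> |S^j X|^2] is log-convex, so the ratio of consecutive
    terms never decreases, and its first value is already at least [s]. *)
Lemma frame_pow_norm_growth c s q X :
  0 < s -> dot l X X <= 1 -> s < dot l (frame_op c X) (frame_op c X) ->
  s ^ S q <= dot l (frame_pow c (S q) X) (frame_pow c (S q) X).
Proof.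
  intros Hs HX H1.
  set (x := fun j => dot l (frame_pow c j X) (frame_pow c j X)).
  assert (conv : forall j, x (S j) ^ 2 <= x j * x (S (S j))).
  { intros j. unfold x. rewrite !dot_frame_pow.
    destruct (hankel_frame_pow c X) as [_ H].
    specialize (H j (S (S j))). cbv beta in H.
    replace (S j + S j)%nat with (j + S (S j))%nat by lia.
    replace (j + j)%nat with (2 * j)%nat by lia.
    replace (S (S j) + S (S j))%nat with (2 * S (S j))%nat by lia. exact H. }
  assert (pos : forall j, 0 <= x j) by (intros; apply dot_nonneg).
  assert (grow : forall j, s * x j <= x (S j) /\ s ^ S j <= x (S j)).
  { induction j as [|j [I1 I2]].
    - change (x 1%nat) with (dot l (frame_op c X) (frame_op c X)).
      change (x O) with (dot l X X). split; simpl; nra.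
    - assert (0 < s ^ S j) by (apply pow_lt; auto).
      specialize (conv j). pose proof (pos j). pose proof (pos (S (S j))).
      assert (G1 : s * x (S j) <= x (S (S j))).
      { apply Rnot_lt_le; intros L.
        (* If [x j] vanished, log-convexity would force [x (S j) = 0], against the lower bound
           [s ^ S j] carried along in the induction. *)
        assert (0 < x j) by (destruct (Rle_lt_or_eq_dec _ _ (pos j)); [auto|nra]).
        assert (x j * x (S (S j)) < x j * (s * x (S j)))
          by (apply Rmult_lt_compat_l; auto).
        assert (s * x j * x (S j) <= x (S j) * x (S j))
          by (apply Rmult_le_compat_r; lra).
        nra. }
      split; auto. change (s ^ S (S j)) with (s * s ^ S j). nra. }
  apply grow.
Qed.

End Frame.

(** * Bernoulli expectations and conditioning on one bit *)

Lemma upd_same d a b v v' : upd (upd d a b v) a b v' = upd d a b v'.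
Proof.
  extensionality a'; extensionality b'; unfold upd.
  destruct (_ && _)%bool; reflexivity.
Qed.

Lemma upd_comm d a b v a' b' v' :
  (a, b) <> (a', b') ->
  upd (upd d a b v) a' b' v' = upd (upd d a' b' v') a b v.
Proof.
  intros H. extensionality x; extensionality y; unfold upd.
  destruct (Nat.eqb_spec a x), (Nat.eqb_spec b y), (Nat.eqb_spec a' x),
    (Nat.eqb_spec b' y); simpl; congruence.
Qed.

Lemma upd_eq d a b v : upd d a b v a b = v.
Proof. unfold upd; rewrite !Nat.eqb_refl; reflexivity. Qed.

Lemma upd_neq d a b v x y : (x, y) <> (a, b) -> upd d a b v x y = d x y.
Proof.
  intros H; unfold upd.
  destruct (Nat.eqb_spec a x), (Nat.eqb_spec b y); simpl; congruence.
Qed.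

Lemma bern_exp_plus p cells F F' :
  bern_exp p cells (fun d => F d + F' d)
  = bern_exp p cells F + bern_exp p cells F'.
Proof.
  revert F F'; induction cells as [|[a b] l IH]; intros; simpl; [reflexivity|].
  rewrite !IH; ring.
Qed.

Lemma bern_exp_scal p cells k F :
  bern_exp p cells (fun d => k * F d) = k * bern_exp p cells F.
Proof.
  revert F; induction cells as [|[a b] l IH]; intros; simpl; [reflexivity|].
  rewrite !IH; ring.
Qed.

Lemma bern_exp_const p cells k : bern_exp p cells (fun _ => k) = k.
Proof. induction cells as [|[a b] l IH]; simpl; [|rewrite IH; ring]; auto. Qed.

Lemma bern_exp_le p cells F F' :
  0 <= p <= 1 -> (forall d, F d <= F' d) ->
  bern_exp p cells F <= bern_exp p cells F'.
Proof.
  intros Hp; revert F F'; induction cells as [|[a b] l IH]; intros F F' H; simpl;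
    [auto|].
  apply Rplus_le_compat; apply Rmult_le_compat_l; try lra; apply IH; auto.
Qed.

Lemma bern_exp_lsum {A} p cells (s : list A) F :
  bern_exp p cells (fun d => lsum s (fun i => F i d))
  = lsum s (fun i => bern_exp p cells (F i)).
Proof.
  induction s as [|i s IH]; simpl; [apply bern_exp_const|].
  rewrite bern_exp_plus; f_equal; exact IH.
Qed.

(** Updates at different cells commute and a later update of the same cell overwrites the earlier
    one, so the bit of any listed cell can be averaged first. *)
Lemma bern_exp_condition p cells a b F :
  In (a, b) cells ->
  bern_exp p cells F
  = p * bern_exp p cells (fun d => F (upd d a b true))
    + (1 - p) * bern_exp p cells (fun d => F (upd d a b false)).
Proof.
  revert F; induction cells as [|[x y] l IH]; intros F; [simpl; tauto|].
  intros Hin. destruct (classic ((a, b) = (x, y))) as [[= -> ->]|Hne].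
  - simpl.
    replace (fun d => F (upd (upd d x y true) x y true))
      with (fun d => F (upd d x y true))
      by (extensionality d; rewrite upd_same; reflexivity).
    replace (fun d => F (upd (upd d x y false) x y true))
      with (fun d => F (upd d x y true))
      by (extensionality d; rewrite upd_same; reflexivity).
    replace (fun d => F (upd (upd d x y true) x y false))
      with (fun d => F (upd d x y false))
      by (extensionality d; rewrite upd_same; reflexivity).
    replace (fun d => F (upd (upd d x y false) x y false))
      with (fun d => F (upd d x y false))
      by (extensionality d; rewrite upd_same; reflexivity).
    ring.
  - destruct Hin as [E|Hin]; [congruence|].
    assert (C : forall v v', (fun d => F (upd (upd d x y v) a b v'))
      = (fun d => F (upd (upd d a b v') x y v)))
      by (intros; extensionality d; rewrite upd_comm by congruence; reflexivity).
    simpl.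
    rewrite (IH (fun d => F (upd d x y true)) Hin),
      (IH (fun d => F (upd d x y false)) Hin), !C.
    ring.
Qed.

(** * Moment recursion and tail bound for random weights *)

Section BernoulliFrame.

Context (l : list (nat * nat)) (G : nat * nat -> nat * nat -> R) (p B : R).
Hypothesis l_nodup : NoDup l.
Hypothesis G_sym : forall i j, G i j = G j i.
Hypothesis G_idem : forall i j, In i l -> In j l -> dot l (G i) (G j) = G i j.
Hypothesis p_range : 0 < p <= 1.
Hypothesis B_nonneg : 0 <= B.
Hypothesis G_diag : forall i, In i l -> G i i <= B.

Definition weight (delta : nat -> nat -> bool) (x : nat * nat) : R :=
  (if delta (fst x) (snd x) then 1 else 0) / p - 1.

Definition mean_moment (k : nat) : R :=
  bern_exp p l (fun d => moment l G (weight d) k).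

(** Switching the bit on raises its weight by [/ p], so this is the rank-one bound with [t = / p];
    the even moments are nonnegative, which allows [G e e] to be replaced by [B]. *)
Lemma weight_perturb_bound d a b N :
  In (a, b) l ->
  let g c k := dot l (G (a, b)) (frame_pow l G c k (G (a, b))) in
  let c1 := weight (upd d a b true) in
  let c0 := weight (upd d a b false) in
  g c1 (2 * N + 1)%nat - g c0 (2 * N + 1)%nat
  <= INR (2 * N + 1) / 2 * (B / p) * (g c1 (2 * N)%nat + g c0 (2 * N)%nat).
Proof.
  intros Hin g c1 c0.
  assert (Hp : 0 < / p) by (apply Rinv_0_lt_compat; lra).
  eapply Rle_trans.
  - apply (frame_pow_perturb_bound l G l_nodup G_idem c0 c1 (a, b) (/ p)); auto.
    + lra.
    + unfold c1, c0, weight; simpl; rewrite !upd_eq; field; lra.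
    + intros [x y] _ Hne. unfold c1, c0, weight; simpl.
      rewrite !upd_neq by congruence. reflexivity.
  - fold (g c1 (2 * N)%nat). fold (g c0 (2 * N)%nat).
    assert (0 <= g c1 (2 * N)%nat) by apply (hankel_frame_pow l G c1 (G (a, b))).
    assert (0 <= g c0 (2 * N)%nat) by apply (hankel_frame_pow l G c0 (G (a, b))).
    apply Rmult_le_compat_r; [lra|].
    replace (INR (2 * N + 1) / 2 * (B / p)) with
      (/ p * INR (2 * N + 1) / 2 * B) by (field; lra).
    apply Rmult_le_compat_l; auto.
    apply Rmult_le_pos; [|lra]. apply Rmult_le_pos; [lra|apply pos_INR].
Qed.

Lemma mean_moment_step N :
  mean_moment (2 * (N + 1))
  <= INR (2 * N + 1) / 2 * (B / p)
     * (mean_moment (2 * N + 1) + 2 * mean_moment (2 * N)).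
Proof.
  set (K := INR (2 * N + 1) / 2 * (B / p)).
  assert (HK : 0 <= K).
  { unfold K, Rdiv. repeat apply Rmult_le_pos; try lra; [apply pos_INR|].
    left; apply Rinv_0_lt_compat; lra. }
  set (g := fun k j d => dot l (G j) (frame_pow l G (weight d) k (G j))).
  assert (E1 : mean_moment (2 * (N + 1))
    = lsum l (fun j => bern_exp p l (fun d => weight d j * g (2 * N + 1)%nat j d))).
  { unfold mean_moment. rewrite <- bern_exp_lsum. f_equal. extensionality d.
    replace (2 * (N + 1))%nat with (S (2 * N + 1)) by lia.
    apply moment_succ; auto. }
  (* By [moment_succ] the odd moment is also a weighted sum of the diagonal terms of order [2 * N],
     so the right side becomes one sum over cells, compared with [E1] cell by cell. *)
  assert (E2 : mean_moment (2 * N + 1) + 2 * mean_moment (2 * N)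
    = lsum l (fun j => bern_exp p l (fun d => (weight d j + 2) * g (2 * N)%nat j d))).
  { unfold mean_moment. rewrite <- bern_exp_lsum, <- bern_exp_scal, <- bern_exp_plus.
    f_equal. extensionality d.
    replace (2 * N + 1)%nat with (S (2 * N)) by lia.
    rewrite moment_succ by auto. unfold moment. rewrite <- lsum_scal, <- lsum_plus.
    apply lsum_ext; intros; unfold g; ring. }
  rewrite E1, E2, <- lsum_scal. apply lsum_le. intros [a b] Hin.
  rewrite (bern_exp_condition p l a b (fun d => weight d (a, b) * _) Hin),
    (bern_exp_condition p l a b (fun d => (weight d (a, b) + 2) * _) Hin).
  set (up := fun v (F : (nat -> nat -> bool) -> R) =>
    bern_exp p l (fun d => F (upd d a b v))).
  assert (W1 : forall d, weight (upd d a b true) (a, b) = / p - 1)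
    by (intros; unfold weight; simpl; rewrite upd_eq; field; lra).
  assert (W0 : forall d, weight (upd d a b false) (a, b) = - 1)
    by (intros; unfold weight; simpl; rewrite upd_eq; field; lra).
  replace (fun d => weight (upd d a b true) (a, b) * g (2 * N + 1)%nat (a, b) (upd d a b true))
    with (fun d => (/ p - 1) * g (2 * N + 1)%nat (a, b) (upd d a b true))
    by (extensionality d; rewrite W1; reflexivity).
  replace (fun d => weight (upd d a b false) (a, b) * g (2 * N + 1)%nat (a, b) (upd d a b false))
    with (fun d => (- 1) * g (2 * N + 1)%nat (a, b) (upd d a b false))
    by (extensionality d; rewrite W0; reflexivity).
  replace (fun d => (weight (upd d a b true) (a, b) + 2) * g (2 * N)%nat (a, b) (upd d a b true))
    with (fun d => (/ p + 1) * g (2 * N)%nat (a, b) (upd d a b true))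
    by (extensionality d; rewrite W1; ring).
  replace (fun d => (weight (upd d a b false) (a, b) + 2) * g (2 * N)%nat (a, b) (upd d a b false))
    with (fun d => 1 * g (2 * N)%nat (a, b) (upd d a b false))
    by (extensionality d; rewrite W0; ring).
  rewrite !bern_exp_scal.
  fold (up true (g (2 * N + 1)%nat (a, b))). fold (up false (g (2 * N + 1)%nat (a, b))).
  fold (up true (g (2 * N)%nat (a, b))). fold (up false (g (2 * N)%nat (a, b))).
  assert (D : up true (g (2 * N + 1)%nat (a, b)) + (-1) * up false (g (2 * N + 1)%nat (a, b))
    <= K * (up true (g (2 * N)%nat (a, b)) + up false (g (2 * N)%nat (a, b)))).
  { unfold up. rewrite <- bern_exp_scal, <- !bern_exp_plus, <- bern_exp_scal.
    apply bern_exp_le; [lra|]. intros d.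
    pose proof (weight_perturb_bound d a b N Hin) as P. unfold g, K. lra. }
  assert (P1 : 0 <= up true (g (2 * N)%nat (a, b))).
  { unfold up. rewrite <- (bern_exp_const p l 0). apply bern_exp_le; [lra|].
    intros d. apply (hankel_frame_pow l G (weight (upd d a b true)) (G (a, b))). }
  set (x1 := up true (g (2 * N + 1)%nat (a, b))) in *.
  set (x0 := up false (g (2 * N + 1)%nat (a, b))) in *.
  set (y1 := up true (g (2 * N)%nat (a, b))) in *.
  set (y0 := up false (g (2 * N)%nat (a, b))) in *.
  (* Because the weight is centered, the left side is [1 - p] times the difference bounded in [D].
     The right side is [1 - p] times that bound plus the nonnegative surplus [2 * p * (K * y1)]. *)
  replace (p * ((/ p - 1) * x1) + (1 - p) * (- 1 * x0))
    with ((1 - p) * (x1 + -1 * x0)) by (field; lra).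
  replace (K * (p * ((/ p + 1) * y1) + (1 - p) * (1 * y0)))
    with ((1 - p) * (K * (y1 + y0)) + 2 * p * (K * y1)) by (field; lra).
  assert (0 <= K * y1) by (apply Rmult_le_pos; auto).
  apply (Rmult_le_compat_l (1 - p)) in D; [|lra].
  assert (0 <= 2 * p * (K * y1)) by (apply Rmult_le_pos; lra). lra.
Qed.

Lemma mean_moment_even_nonneg N : 0 <= mean_moment (2 * N).
Proof.
  rewrite <- (bern_exp_const p l 0). apply bern_exp_le; [lra|].
  intros d; apply moment_even_nonneg.
Qed.

(** Keeping [q] fixed while [k] runs up to it bounds all recursion coefficients by the same
    [Q = q B / p]. *)
Lemma mean_moment_bound q k :
  INR q * (B / p) <= 1 -> (k <= q)%nat ->
  mean_moment (2 * k) <= (5 * (INR q * (B / p))) ^ k * INR (length l).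
Proof.
  intros Hq. set (b := B / p) in *.
  assert (Hb : 0 <= b).
  { apply Rmult_le_pos; auto. left; apply Rinv_0_lt_compat; lra. }
  induction k as [|k IH]; intros Hk.
  - rewrite pow_O, Rmult_1_l, <- (bern_exp_const p l (INR _)).
    apply bern_exp_le; [lra|]. intros d. apply moment_zero_le; auto.
  - specialize (IH ltac:(lia)).
    pose proof (mean_moment_step k) as S1. fold b in S1.
    pose proof (mean_moment_even_nonneg k) as P0.
    pose proof (mean_moment_even_nonneg (k + 1)) as P1.
    assert (O1 : mean_moment (2 * k + 1)
      <= (mean_moment (2 * k) + mean_moment (2 * (k + 1))) / 2).
    { unfold Rdiv. rewrite Rmult_comm. unfold mean_moment.
      rewrite <- bern_exp_plus, <- bern_exp_scal. apply bern_exp_le; [lra|].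
      intros d. rewrite Rmult_comm. apply moment_odd_le. }
    replace (S k) with (k + 1)%nat at 1 by lia.
    assert (Kq : INR (2 * k + 1) / 2 * b <= INR q * b).
    { apply Rmult_le_compat_r; auto. apply le_INR in Hk.
      rewrite S_INR in Hk. rewrite plus_INR, mult_INR; simpl; lra. }
    set (x := mean_moment (2 * (k + 1))) in *.
    set (y := mean_moment (2 * k)) in *.
    set (z := mean_moment (2 * k + 1)) in *.
    set (K := INR (2 * k + 1) / 2 * b) in *.
    assert (HK : 0 <= K).
    { unfold K; apply Rmult_le_pos; auto. pose proof (pos_INR (2 * k + 1)); lra. }
    set (Q := INR q * b) in *.
    assert (T : x <= Q * ((y + x) / 2 + 2 * y)).
    { eapply Rle_trans; [exact S1|]. eapply Rle_trans.
      - apply Rmult_le_compat_l; [auto|]. apply Rplus_le_compat_r, O1.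
      - apply Rmult_le_compat_r; lra. }
    (* From [x <= Q * (5 * y / 2 + x / 2)]: since [Q <= 1], the term in [x] on the right is at most
       [x / 2] and is absorbed. *)
    assert (T2 : x <= 5 * Q * y) by nra.
    eapply Rle_trans; [exact T2|].
    change ((5 * Q) ^ S k) with (5 * Q * (5 * Q) ^ k). rewrite (Rmult_assoc (5 * Q)).
    apply Rmult_le_compat_l; [lra|exact IH].
Qed.

(** Markov's inequality: if [S] sends some [X] of the unit ball to squared norm above [s], then
    growth and the trace bound force the moment of order [2 * S q] up to [s ^ S q]. *)
Lemma frame_op_norm_tail q s :
  0 < s -> INR (S q) * (B / p) <= 1 ->
  1 - (5 * (INR (S q) * (B / p)) / s) ^ S q * INR (length l)
  <= bern_exp p l (indicator (fun d => forall X : nat * nat -> R, dot l X X <= 1 ->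
       dot l (frame_op l G (weight d) X) (frame_op l G (weight d) X) <= s)).
Proof.
  intros Hs Hq.
  assert (Hsq : 0 < s ^ S q) by (apply pow_lt; auto).
  pose proof (mean_moment_bound (S q) (S q) Hq (le_n _)) as M.
  (* The integrand [1 - moment / s ^ S q] lies below the indicator pointwise: it is at most 1 always
     and at most 0 off the event. *)
  apply Rle_trans with
    (bern_exp p l (fun d => 1 + (- / s ^ S q) * moment l G (weight d) (2 * S q))).
  - rewrite bern_exp_plus, bern_exp_const, bern_exp_scal.
    fold (mean_moment (2 * S q)).
    unfold Rdiv at 1. rewrite Rpow_mult_distr, pow_inv.
    apply (Rmult_le_compat_l (/ s ^ S q)) in M;
      [|left; apply Rinv_0_lt_compat; auto]. lra.
  - apply bern_exp_le; [lra|]. intros d. unfold indicator.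
    pose proof (moment_even_nonneg l G (weight d) (S q)) as P.
    destruct excluded_middle_informative as [_|H].
    + assert (0 < / s ^ S q) by (apply Rinv_0_lt_compat; auto). nra.
    + apply not_all_ex_not in H as [X H]. apply imply_to_and in H as [HX H].
      apply Rnot_le_lt in H.
      pose proof (frame_pow_norm_growth l G (weight d) s q X Hs HX H) as L.
      pose proof (frame_pow_norm_le_moment l G G_sym G_idem (weight d) q X) as U.
      assert (L2 : s ^ S q <= moment l G (weight d) (2 * S q)).
      { pose proof (dot_nonneg l X). nra. }
      apply (Rmult_le_compat_l (/ s ^ S q)) in L2;
        [|left; apply Rinv_0_lt_compat; auto].
      rewrite Rinv_l in L2 by lra. lra.
Qed.

End BernoulliFrame.

(** * Orthogonal projections and sums over products *)

Definition kron (a x : nat) : R := if Nat.eqb a x then 1 else 0.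

Lemma kron_sym a x : kron a x = kron x a.
Proof. unfold kron; rewrite Nat.eqb_sym; reflexivity. Qed.

Lemma lsum_kron d a f :
  (a < d)%nat -> lsum (seq 0 d) (fun x => kron a x * f x) = f a.
Proof.
  intros Ha. rewrite (lsum_single _ a); [| apply seq_NoDup |apply in_seq; lia|].
  - unfold kron; rewrite Nat.eqb_refl; ring.
  - intros x _ Hx. unfold kron. destruct (Nat.eqb_spec a x); [congruence|ring].
Qed.

Lemma proj_sym r u a c : proj r u a c = proj r u c a.
Proof. unfold proj; rewrite !sumR_lsum; apply lsum_ext; intros; ring. Qed.

Lemma proj_idem d r u a b :
  orthonormal d r u -> dot (seq 0 d) (proj r u a) (proj r u b) = proj r u a b.
Proof.
  intros Hu.
  assert (E : forall X c, dot (seq 0 d) X (proj r u c)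
    = lsum (seq 0 r) (fun k => u k c * dot (seq 0 d) X (u k))).
  { intros X c. rewrite <- dot_lsum_r. apply dot_ext_r; intros i _.
    unfold proj; apply sumR_lsum. }
  rewrite E. unfold proj at 2. rewrite sumR_lsum. apply lsum_ext. intros k Hk.
  apply in_seq in Hk. rewrite dot_comm, E, Rmult_comm. f_equal.
  rewrite <- (lsum_kron r k (fun l => u l a)) by lia.
  apply lsum_ext; intros l Hl. apply in_seq in Hl.
  specialize (Hu k l ltac:(lia) ltac:(lia)). rewrite sumR_lsum in Hu.
  fold (dot (seq 0 d) (u k) (u l)) in Hu. rewrite Hu. unfold kron; ring.
Qed.

(** Idempotence of [I - P], needed for each tensor factor of [PTker]. *)
Lemma compl_idem d r u a b :
  orthonormal d r u -> (a < d)%nat -> (b < d)%nat ->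
  lsum (seq 0 d) (fun x => (kron a x - proj r u a x) * (kron b x - proj r u b x))
  = kron a b - proj r u a b.
Proof.
  intros Hu Ha Hb.
  rewrite (lsum_ext _ _ (fun x => (kron a x * (kron b x - proj r u b x)
    + (-1) * (kron b x * proj r u a x)) + proj r u a x * proj r u b x))
    by (intros; ring).
  rewrite !lsum_plus, lsum_scal, !lsum_kron by auto.
  fold (dot (seq 0 d) (proj r u a) (proj r u b)). rewrite (proj_idem d) by auto.
  rewrite (kron_sym b a), (proj_sym r u b a). ring.
Qed.

Lemma lsum_list_prod_mult {A B} (l : list A) (s : list B) f g :
  lsum (list_prod l s) (fun x => f (fst x) * g (snd x)) = lsum l f * lsum s g.
Proof.
  rewrite lsum_list_prod, Rmult_comm, <- lsum_scal.
  apply lsum_ext; intros; simpl. rewrite lsum_scal; ring.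
Qed.

Lemma NoDup_list_prod {A B} (l : list A) (s : list B) :
  NoDup l -> NoDup s -> NoDup (list_prod l s).
Proof.
  intros Hl Hs. induction Hl as [|x l Hx Hl IH]; simpl; [constructor|].
  apply NoDup_app; auto.
  - apply NoDup_map_NoDup_ForallPairs; auto. intros y y' _ _; congruence.
  - intros [x' y] H1 H2. apply in_map_iff in H1 as [y' [[= -> ->] _]].
    apply in_prod_iff in H2 as [H2 _]; auto.
Qed.

(** * The tangent space projection as a kernel on the cells *)

Definition cells (n1 n2 : nat) : list (nat * nat) :=
  list_prod (seq 0 n1) (seq 0 n2).

Lemma in_cells n1 n2 a b : In (a, b) (cells n1 n2) <-> (a < n1 /\ b < n2)%nat.
Proof. unfold cells; rewrite in_prod_iff, !in_seq; lia. Qed.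

Lemma cells_nodup n1 n2 : NoDup (cells n1 n2).
Proof. apply NoDup_list_prod; apply seq_NoDup. Qed.

(* The matrix of [P_T], in the form [I - (I - P_U) (x) (I - P_V)]. *)
Definition PTker (PU PV : Mat) (i j : nat * nat) : R :=
  kron (fst i) (fst j) * kron (snd i) (snd j)
  - (kron (fst i) (fst j) - PU (fst i) (fst j))
    * (kron (snd i) (snd j) - PV (snd i) (snd j)).

Section TangentSpace.

Context (n1 n2 r : nat) (u v : nat -> nat -> R).
Hypothesis u_orth : orthonormal n1 r u.
Hypothesis v_orth : orthonormal n2 r v.

Let PU := proj r u.
Let PV := proj r v.
Let G := PTker PU PV.
Let l := cells n1 n2.

Lemma PTker_sym i j : G i j = G j i.
Proof.
  unfold G, PTker, PU, PV.
  rewrite (kron_sym (fst i)), (kron_sym (snd i)), (proj_sym r u (fst i)),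
    (proj_sym r v (snd i)). reflexivity.
Qed.

(** Writing the kernel as [I] minus the tensor product of the complementary projections [H] and [K],
    the product expands into four terms, each a product of a row sum and a column sum. *)
Lemma PTker_idem i j : In i l -> In j l -> dot l (G i) (G j) = G i j.
Proof.
  destruct i as [a b], j as [c d]. unfold l. rewrite !in_cells.
  intros [Ha Hb] [Hc Hd].
  set (H := fun a x => kron a x - PU a x). set (K := fun b y => kron b y - PV b y).
  unfold dot, cells.
  rewrite (lsum_ext _ _ (fun x =>
      (kron a (fst x) * kron c (fst x)) * (kron b (snd x) * kron d (snd x))
    + (-1) * ((kron a (fst x) * H c (fst x)) * (kron b (snd x) * K d (snd x)))
    + ((-1) * ((kron c (fst x) * H a (fst x)) * (kron d (snd x) * K b (snd x)))
    + (H a (fst x) * H c (fst x)) * (K b (snd x) * K d (snd x)))))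
    by (intros; unfold G, PTker, H, K; simpl; ring).
  rewrite !lsum_plus, !lsum_scal.
  rewrite (lsum_list_prod_mult _ _ (fun x => kron a x * kron c x)
      (fun y => kron b y * kron d y)),
    (lsum_list_prod_mult _ _ (fun x => kron a x * H c x) (fun y => kron b y * K d y)),
    (lsum_list_prod_mult _ _ (fun x => kron c x * H a x) (fun y => kron d y * K b y)),
    (lsum_list_prod_mult _ _ (fun x => H a x * H c x) (fun y => K b y * K d y)).
  unfold H at 3 4, K at 3 4, PU, PV.
  rewrite !compl_idem, !lsum_kron by auto.
  unfold G, PTker, H, K, PU, PV; simpl.
  rewrite (kron_sym c a), (kron_sym d b), (proj_sym r u c a), (proj_sym r v d b).
  ring.
Qed.

Lemma dot_PTker X a b :
  (a < n1)%nat -> (b < n2)%nat ->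
  dot l (G (a, b)) (fun x => X (fst x) (snd x)) = PT n1 n2 PU PV X a b.
Proof.
  intros Ha Hb. unfold dot, l, cells. rewrite lsum_list_prod.
  (* The kernel regrouped as [I (x) P_V + P_U (x) I - P_U (x) P_V], with the column sum against
     [kron b] carried out. *)
  rewrite (lsum_ext _ _ (fun x =>
    kron a x * lsum (seq 0 n2) (fun y => PV b y * X x y)
    + (PU a x * X x b
       + (-1) * lsum (seq 0 n2) (fun y => PU a x * X x y * PV y b)))).
  - rewrite !lsum_plus, lsum_kron, lsum_scal, lsum_swap by auto.
    unfold PT, mulmat. rewrite !sumR_lsum.
    rewrite (lsum_ext (seq 0 n2) (fun y => PV b y * _) (fun y => X a y * PV y b))
      by (intros; unfold PV; rewrite (proj_sym r v b); ring).
    rewrite (lsum_ext (seq 0 n2) (fun y => lsum _ _)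
      (fun y => sumR n1 (fun c => PU a c * X c y) * PV y b)).
    + ring.
    + intros y _. rewrite sumR_lsum, Rmult_comm, <- lsum_scal.
      apply lsum_ext; intros; ring.
  - intros x _. rewrite <- (lsum_kron n2 b (fun y => X x y)) at 1 by auto.
    rewrite <- !lsum_scal, <- !lsum_plus. apply lsum_ext. intros y _.
    unfold G, PTker; simpl. unfold PV; rewrite (proj_sym r v y b). ring.
Qed.

Lemma frob_dot X :
  frob n1 n2 X = sqrt (dot l (fun x => X (fst x) (snd x)) (fun x => X (fst x) (snd x))).
Proof.
  unfold frob, dot, l, cells. f_equal. rewrite lsum_list_prod, sumR_lsum.
  apply lsum_ext; intros. rewrite sumR_lsum. apply lsum_ext; intros; simpl; ring.
Qed.

(** Sampling keeps the terms [<G i, X> G i] with [delta_i = 1], while [frame_expand] writes [P_T X]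
    as the sum of all of them; the difference has coefficients [delta_i - p = p * weight]. *)
Lemma PT_POmega_PT_frame_op p d X a b :
  p <> 0 -> (a < n1)%nat -> (b < n2)%nat ->
  PT n1 n2 PU PV (POmega d (PT n1 n2 PU PV X)) a b - p * PT n1 n2 PU PV X a b
  = p * frame_op l G (weight p d) (fun x => X (fst x) (snd x)) (a, b).
Proof.
  intros Hp Ha Hb. set (Y := fun x : nat * nat => X (fst x) (snd x)).
  assert (Hin : In (a, b) l) by (apply in_cells; auto).
  rewrite <- (dot_PTker (POmega d _)), <- (dot_PTker X) by auto. fold Y.
  rewrite <- (frame_expand l G PTker_sym PTker_idem Y (a, b) Hin).
  set (Z := fun x : nat * nat => POmega d _ (fst x) (snd x)).
  transitivity (lsum l (fun i => G (a, b) i * Z i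
    + (- p) * (dot l (G i) Y * dot l (G i) (G (a, b))))).
  { rewrite lsum_plus, lsum_scal. unfold dot at 1. ring. }
  unfold frame_op. rewrite <- lsum_scal. apply lsum_ext. intros [x y] Hxy.
  apply in_cells in Hxy as Hxy'.
  rewrite (PTker_idem (x, y) (a, b)), (PTker_sym (a, b)) by auto.
  unfold Z, POmega, weight; simpl.
  rewrite <- (dot_PTker X) by tauto. fold Y.
  destruct (d x y); field; auto.
Qed.

End TangentSpace.

(** * Coherence estimates and numerical bounds *)

Lemma maxR_ge n f i : (i < n)%nat -> f i <= maxR n f.
Proof.
  induction n as [|[|n] IH]; intros Hi; [lia| |].
  - replace i with O by lia. simpl; lra.
  - change (maxR (S (S n)) f) with (Rmax (maxR (S n) f) (f (S n))).
    destruct (Nat.eq_dec i (S n)) as [->|]; [apply Rmax_r|].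
    eapply Rle_trans; [apply IH; lia|apply Rmax_l].
Qed.

(** The squared norm of [P e_i] in the coherence equals the diagonal entry of [P] by idempotence. *)
Lemma proj_diag_le d r u mu i :
  (1 <= r)%nat -> orthonormal d r u -> coherence d r (proj r u) <= mu ->
  (i < d)%nat -> 0 <= proj r u i i /\ INR d * proj r u i i <= mu * INR r.
Proof.
  intros Hr Hu Hc Hi.
  assert (r0 : 0 < INR r) by (apply lt_0_INR; lia).
  assert (d0 : 0 < INR d) by (apply lt_0_INR; lia).
  split.
  - rewrite <- (proj_idem d) by auto. apply dot_nonneg.
  - unfold coherence in Hc.
    pose proof (maxR_ge d (fun i => sumR d (fun j => proj r u j i ^ 2)) i Hi) as M.
    assert (E : sumR d (fun j => proj r u j i ^ 2) = proj r u i i).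
    { rewrite <- (proj_idem d) at 1 by auto. rewrite sumR_lsum.
      apply lsum_ext; intros j _. rewrite (proj_sym r u j i); ring. }
    cbv beta in M. rewrite E in M. set (w := maxR _ _) in *.
    apply (Rmult_le_compat_r (INR r)) in Hc; [|lra].
    replace (INR d / INR r * w * INR r) with (INR d * w) in Hc by (field; lra).
    nra.
Qed.

(** If [mu <= 0], the diagonal of the projection vanishes, hence so does the unit vector [u O]. *)
Lemma coherence_pos d r u mu :
  (1 <= r)%nat -> (1 <= d)%nat -> orthonormal d r u ->
  coherence d r (proj r u) <= mu -> 0 < mu.
Proof.
  intros Hr Hd Hu Hc. apply Rnot_le_lt; intros Hmu.
  assert (r0 : 0 < INR r) by (apply lt_0_INR; lia).
  assert (d0 : 0 < INR d) by (apply lt_0_INR; lia).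
  assert (D : forall i, (i < d)%nat -> u O i * u O i = 0).
  { intros i Hi. destruct (proj_diag_le d r u mu i Hr Hu Hc Hi) as [H0 H1].
    assert (proj r u i i <= 0) by nra.
    assert (L : u O i * u O i <= proj r u i i).
    { unfold proj. rewrite sumR_lsum.
      apply (lsum_ge_term (seq 0 r) O (fun k => u k i * u k i));
        [apply in_seq; lia|]. intros k; apply Rle_0_sqr. }
    pose proof (Rle_0_sqr (u O i)). unfold Rsqr in *. lra. }
  specialize (Hu O O ltac:(lia) ltac:(lia)). simpl in Hu.
  rewrite sumR_lsum, lsum_zero in Hu; [lra|].
  intros i Hi. apply in_seq in Hi. apply D; lia.
Qed.

(** The integer is given as a successor because the norm estimates use positive powers. *)
Lemma nat_ceil x : 0 < x -> exists q : nat, x <= INR (S q) <= x + 1.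
Proof.
  intros Hx. destruct (archimed x) as [H1 H2].
  assert (0 < up x)%Z by (apply lt_IZR; simpl; lra).
  exists (Z.to_nat (up x) - 1)%nat.
  replace (S (Z.to_nat (up x) - 1)) with (Z.to_nat (up x)) by lia.
  rewrite INR_IZR_INZ, Z2Nat.id by lia. lra.
Qed.

Lemma indicator_le {A} (E E' : A -> Prop) x :
  (E x -> E' x) -> indicator E x <= indicator E' x.
Proof.
  intros H; unfold indicator.
  destruct (excluded_middle_informative (E x)),
    (excluded_middle_informative (E' x)); try lra; tauto.
Qed.

Lemma bern_prob_nonneg p n1 n2 E : 0 <= p <= 1 -> 0 <= bern_prob p n1 n2 E.
Proof.
  intros Hp. unfold bern_prob.
  rewrite <- (bern_exp_const p (list_prod (seq 0 n1) (seq 0 n2)) 0).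
  apply bern_exp_le; auto. intros d; unfold indicator.
  destruct excluded_middle_informative; lra.
Qed.

(* With [q] about [3 beta ln n], the bound on the mean moment divided by
   [s^q] is at most [exp (-q) n^2 <= n^(2 - 3 beta)]. *)
Lemma moment_tail_numeric q x N n beta :
  0 <= x <= / 3 -> 1 < n -> 1 < beta -> 0 <= N <= n ^ 2 ->
  3 * (beta * ln n) <= INR q -> x ^ q * N <= Rpower n (- beta).
Proof.
  intros [x0 x1] Hn Hb [N0 N1] Hq.
  assert (L : 0 < ln n) by (rewrite <- ln_1; apply ln_increasing; lra).
  assert (e : x <= exp (- (1))).
  { rewrite exp_Ropp. eapply Rle_trans; [exact x1|].
    apply Rinv_le_contravar; [apply exp_pos|apply exp_le_3]. }
  assert (E : x ^ q <= exp (- INR q)).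
  { eapply Rle_trans; [apply pow_incr; split; eassumption|].
    rewrite <- Rpower_pow by apply exp_pos. unfold Rpower. rewrite ln_exp.
    right; f_equal; ring. }
  assert (E2 : n ^ 2 = exp (2 * ln n)).
  { rewrite <- (Rpower_pow 2 n) by lra. unfold Rpower; simpl.
    f_equal; ring. }
  apply Rle_trans with (exp (- INR q) * exp (2 * ln n)).
  - apply Rmult_le_compat; auto; [apply pow_le; auto|]. lra.
  - rewrite <- exp_plus. unfold Rpower.
    assert (Le : - INR q + 2 * ln n <= - beta * ln n) by nra.
    destruct Le as [Lt|Eq]; [left; apply exp_increasing; exact Lt|].
    rewrite Eq; apply Rle_refl.
Qed.

(** * Choice of parameters and transfer to the matrix operator *)

Theorem theorem4p1 :
  exists CR : R,
  forall (n1 n2 r m : nat) (u v : nat -> nat -> R) (mu0 beta : R),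
    (1 <= r)%nat -> (1 <= m)%nat -> (m <= n1 * n2)%nat ->
    orthonormal n1 r u -> orthonormal n2 r v ->
    Rmax (coherence n1 r (proj r u)) (coherence n2 r (proj r v)) <= mu0 ->
    1 < beta ->
    let n := Nat.max n1 n2 in
    let p := INR m / (INR n1 * INR n2) in
    let bound := CR * sqrt (mu0 * INR n * INR r * (beta * ln (INR n)) / INR m) in
    bound < 1 ->
    bern_prob p n1 n2
      (fun delta =>
         forall X : Mat, frob n1 n2 X <= 1 ->
           / p * frob n1 n2
             (fun a b => PT n1 n2 (proj r u) (proj r v)
                           (POmega delta (PT n1 n2 (proj r u) (proj r v) X)) a b
                         - p * PT n1 n2 (proj r u) (proj r v) X a b)
           <= bound)
    >= 1 - 3 * Rpower (INR n) (- beta).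
Proof.
  (* The Markov ratio below is at most [5 * 10 * y / (13^2 * y) = 50 / 169], and
     [moment_tail_numeric] asks for at most [/ 3]; 13 is the least integer that achieves this. *)
  exists 13. intros n1 n2 r m u v mu0 beta Hr Hm Hmn Hu Hv Hmu Hbeta n p bound Hbound.
  apply Rle_ge.
  assert (d1 : (1 <= n1)%nat) by nia. assert (d2 : (1 <= n2)%nat) by nia.
  assert (i1 : 1 <= INR n1) by (apply (le_INR 1); auto).
  assert (i2 : 1 <= INR n2) by (apply (le_INR 1); auto).
  assert (im : 1 <= INR m) by (apply (le_INR 1); auto).
  assert (ir : 1 <= INR r) by (apply (le_INR 1); auto).
  assert (imn : INR m <= INR n1 * INR n2) by (rewrite <- mult_INR; apply le_INR; auto).
  assert (nn1 : INR n1 <= INR n) by (apply le_INR; lia).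
  assert (nn2 : INR n2 <= INR n) by (apply le_INR; lia).
  assert (i12 : 1 <= INR n1 * INR n2) by nra.
  assert (Hp : 0 < p <= 1).
  { unfold p, Rdiv; split.
    - apply Rmult_lt_0_compat; [lra|apply Rinv_0_lt_compat; lra].
    - apply (Rmult_le_reg_r (INR n1 * INR n2)); [lra|].
      rewrite Rmult_assoc, Rinv_l; lra. }
  (* For [n = 1] the claimed lower bound is [1 - 3 < 0]; from [n = 2] on, [ln n] exceeds [/ 2]. *)
  destruct (le_lt_dec n 1) as [Hn|Hn].
  { assert (E1 : n = 1%nat) by lia.
    rewrite E1; unfold Rpower; simpl. rewrite ln_1, Rmult_0_r, exp_0.
    eapply Rle_trans; [|apply bern_prob_nonneg; lra]. lra. }
  assert (Hn2 : 2 <= INR n) by (apply (le_INR 2); lia).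
  assert (Hmu1 : coherence n1 r (proj r u) <= mu0)
    by (eapply Rle_trans; [apply Rmax_l|exact Hmu]).
  assert (Hmu2 : coherence n2 r (proj r v) <= mu0)
    by (eapply Rle_trans; [apply Rmax_r|exact Hmu]).
  assert (mu_pos : 0 < mu0) by (apply (coherence_pos n1 r u mu0); auto).
  assert (HL : / 2 < ln (INR n)).
  { eapply Rlt_le_trans; [apply ln_lt_2|].
    destruct Hn2 as [H| <-]; [left; apply ln_increasing; lra|apply Rle_refl]. }
  set (L := ln (INR n)) in *.
  assert (HbL : / 2 < beta * L) by nra.
  set (K := mu0 * INR n * INR r / INR m).
  assert (K0 : 0 < K).
  { unfold K, Rdiv. repeat apply Rmult_lt_0_compat; try lra.
    apply Rinv_0_lt_compat; lra. }
  set (y := K * (beta * L)).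
  assert (y0 : 0 < y) by (apply Rmult_lt_0_compat; lra).
  assert (Ey : mu0 * INR n * INR r * (beta * L) / INR m = y)
    by (unfold y, K; field; lra).
  assert (Eb : bound = 13 * sqrt y) by (unfold bound; rewrite Ey; reflexivity).
  assert (sy : 0 < sqrt y) by (apply sqrt_lt_R0; auto).
  assert (sy2 : sqrt y * sqrt y = y) by (apply sqrt_sqrt; lra).
  assert (Hy1 : 169 * y < 1) by (rewrite Eb in Hbound; nra).
  set (B := mu0 * INR r / INR n1 + mu0 * INR r / INR n2).
  assert (B0 : 0 <= B).
  { unfold B, Rdiv. apply Rplus_le_le_0_compat;
      (repeat apply Rmult_le_pos; try lra; left; apply Rinv_0_lt_compat; lra). }
  (* Here [B / p = mu0 r (n1 + n2) / m], and [n1 + n2 <= 2 n]. *)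
  assert (HB : B / p <= 2 * K).
  { replace (B / p) with (mu0 * INR r / INR m * (INR n1 + INR n2))
      by (unfold B, p; field; lra).
    replace (2 * K) with (mu0 * INR r / INR m * (2 * INR n))
      by (unfold K; field; lra).
    apply Rmult_le_compat_l; [|lra].
    unfold Rdiv. repeat apply Rmult_le_pos; try lra.
    left; apply Rinv_0_lt_compat; lra. }
  assert (Bp0 : 0 <= B / p)
    by (apply Rmult_le_pos; [auto|left; apply Rinv_0_lt_compat; lra]).
  destruct (nat_ceil (3 * (beta * L))) as [q [q1 q2]]; [lra|].
  (* Since [beta * L > / 2], rounding up costs at most [2 * (beta * L)], so [S q] is at most
     [5 * (beta * L)]. *)
  assert (Hq : INR (S q) * (B / p) <= 10 * y).
  { apply Rle_trans with (5 * (beta * L) * (2 * K)); [|unfold y; lra].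
    apply Rmult_le_compat; try lra. }
  set (l := cells n1 n2).
  set (G := PTker (proj r u) (proj r v)).
  assert (Gsym : forall i j, G i j = G j i) by apply PTker_sym.
  assert (Gid : forall i j, In i l -> In j l -> dot l (G i) (G j) = G i j)
    by (apply PTker_idem; auto).
  assert (Gdiag : forall i, In i l -> G i i <= B).
  { intros [a b] Hab. apply in_cells in Hab as [Ha Hb].
    destruct (proj_diag_le n1 r u mu0 a Hr Hu Hmu1 Ha) as [A0 A1].
    destruct (proj_diag_le n2 r v mu0 b Hr Hv Hmu2 Hb) as [C0 C1].
    unfold G, PTker, kron; simpl. rewrite !Nat.eqb_refl.
    (* The diagonal of the kernel is this sum minus the product of its two nonnegative terms. *)
    apply Rle_trans with (proj r u a a + proj r v b b); [nra|].
    unfold B. apply Rplus_le_compat.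
    - apply (Rmult_le_reg_l (INR n1)); [lra|].
      replace (INR n1 * (mu0 * INR r / INR n1)) with (mu0 * INR r)
        by (field; lra). exact A1.
    - apply (Rmult_le_reg_l (INR n2)); [lra|].
      replace (INR n2 * (mu0 * INR r / INR n2)) with (mu0 * INR r)
        by (field; lra). exact C1. }
  (* The tail bound concerns squared norms, so its threshold is the square of [13 * sqrt y];
     [169 * y < 1] also yields [10 * y <= 1], the condition on the moment order. *)
  assert (s0 : 0 < 169 * y) by lra.
  pose proof (frame_op_norm_tail l G p B (cells_nodup n1 n2) Gsym Gid Hp B0 Gdiag q
    (169 * y) s0 ltac:(lra)) as T.
  assert (N : (5 * (INR (S q) * (B / p)) / (169 * y)) ^ S q * INR (length l)
    <= Rpower (INR n) (- beta)).
  { apply moment_tail_numeric; auto; try lra.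
    - assert (P : 0 <= INR (S q) * (B / p)) by (apply Rmult_le_pos; [apply pos_INR|auto]).
      assert (I : 0 < / (169 * y)) by (apply Rinv_0_lt_compat; lra).
      unfold Rdiv at 1 3; split; [apply Rmult_le_pos; lra|].
      apply (Rmult_le_reg_r (169 * y)); [lra|].
      rewrite Rmult_assoc, Rinv_l; lra.
    - unfold l, cells. rewrite length_prod, !length_seq, mult_INR. split; nra. }
  assert (R0 : 0 < Rpower (INR n) (- beta)) by apply exp_pos.
  apply Rle_trans with (1 - Rpower (INR n) (- beta)); [lra|].
  eapply Rle_trans; [apply Rplus_le_compat_l, Ropp_le_contravar, N|].
  eapply Rle_trans; [exact T|].
  unfold bern_prob. fold (cells n1 n2). fold l.
  apply bern_exp_le; [lra|]. intros d. apply indicator_le. intros H X HX.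
  rewrite (frob_dot n1 n2 X) in HX. fold l in HX.
  set (x := fun z : nat * nat => X (fst z) (snd z)) in *.
  assert (Hx : dot l x x <= 1).
  { pose proof (dot_nonneg l x) as P. pose proof (sqrt_pos (dot l x x)).
    rewrite <- (sqrt_sqrt (dot l x x)) by auto. nra. }
  specialize (H x Hx).
  rewrite frob_dot. fold l.
  set (D := fun z : nat * nat => PT _ _ _ _ _ (fst z) (snd z) - _).
  (* The deviation is [p] times the frame operator, so the factor [/ p] in the claim cancels after
     the square root. *)
  assert (ED : dot l D D = p ^ 2 * dot l (frame_op l G (weight p d) x) (frame_op l G (weight p d) x)).
  { unfold dot at 1 2. rewrite <- lsum_scal. apply lsum_ext. intros [a b] Hab.
    apply in_cells in Hab as [Ha Hb]. unfold D; simpl fst; simpl snd.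
    rewrite (PT_POmega_PT_frame_op n1 n2 r u v Hu Hv p d X a b) by (auto; lra).
    fold l G x. ring. }
  rewrite ED, sqrt_mult_alt by (apply pow2_ge_0).
  rewrite sqrt_pow2 by lra. rewrite <- Rmult_assoc, Rinv_l, Rmult_1_l by lra.
  rewrite Eb. replace (13 * sqrt y) with (sqrt (169 * y)).
  - apply sqrt_le_1_alt, H.
  - replace 169 with (13 ^ 2) by ring. rewrite sqrt_mult_alt by apply pow2_ge_0.
    rewrite sqrt_pow2 by lra. reflexivity.
Qed.
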